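(* Let $\varrho$ be a substitution on a compact Hausdorff alphabet $\mathcal{A}$ with substitution operator $M$. If $\mathcal{A}$ is infinite and $\varrho$ is letter surjective, then $M$ is not a compact operator.
   Context: $\mathcal{A}$ is a compact Hausdorff space and $\mathcal{A}^+=\bigsqcup_{n\ge1}\mathcal{A}^n$ is the space of non-empty finite words (disjoint union of product topologies). A substitution is a continuous map $\varrho\colon\mathcal{A}\to\mathcal{A}^+$. It is letter surjective if every letter $a\in\mathcal{A}$ occurs in $\varrho(b)$ for some $b\in\mathcal{A}$. $E=C(\mathcal{A})$ is the Banach space of continuous real-valued functions on $\mathcal{A}$ with supremum norm and $M\colon E\to E$ is $(Mf)(a)=\sum_{b\triangleleft\varrho(a)}f(b)$, summing over all letters $b$ of $\varrho(a)$ with multiplicity. *)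

(* Defs.v *)
From HB Require Import structures.
From mathcomp Require Import all_boot all_order all_algebra.
From mathcomp Require Import all_classical all_reals all_analysis.

Set Implicit Arguments.
Unset Strict Implicit.
Unset Printing Implicit Defensive.

Import Order.TTheory GRing.Theory Num.Theory.
Import numFieldNormedType.Exports.

Local Open Scope classical_set_scope.
Local Open Scope ring_scope.

HB.mixin Record Topological_isCompactHausdorff T & Topological T := {
  compact_setT : compact [set: T];
  hausdorff_setT : hausdorff_space T
}.

#[short(type="compactHausdorffType")]
HB.structure Definition CompactHausdorff :=
  {T of Topological T & Topological_isCompactHausdorff T}.

(* The space C(A): an alias of the type of continuous functions, which
   keeps the topology of the supremum norm apart from the topologies that the
   library may put on continuousType. *)
Definition Cspace (A : compactHausdorffType) (R : realType) : Type :=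
  continuousType A R.

Section Cspace_normed.
Context {A : compactHausdorffType} {R : realType}.
Implicit Types f g : Cspace A R.

HB.instance Definition _ := Choice.on (Cspace A R).

Definition mkCspace (f : A -> R) (cf : continuous f) : Cspace A R :=
  (mkcts cf : continuousType A R).

Lemma mkCspaceE (f : A -> R) (cf : continuous f) a : mkCspace cf a = f a.
Proof. by []. Qed.

Lemma CspaceP f g : f = g <-> (forall a, f a = g a).
Proof. exact: continuousEP. Qed.

Lemma Cspace_continuous f : continuous (f : A -> R).
Proof. exact: cts_fun. Qed.

Definition Cspace0 : Cspace A R := mkCspace (@cst_continuous A R 0).

Lemma Copp_subproof f : continuous (fun a => - f a).
Proof. by move=> a; apply: cvgN; exact: Cspace_continuous. Qed.

Lemma Cadd_subproof f g : continuous (fun a => f a + g a).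
Proof. by move=> a; apply: cvgD; exact: Cspace_continuous. Qed.

Lemma Cscale_subproof (k : R) f : continuous (fun a => k * f a).
Proof. by move=> a; apply: cvgMr; exact: Cspace_continuous. Qed.

Definition Cspace_opp f := mkCspace (@Copp_subproof f).
Definition Cspace_add f g := mkCspace (@Cadd_subproof f g).
Definition Cspace_scale k f := mkCspace (@Cscale_subproof k f).

Fact Cspace_addA : associative Cspace_add.
Proof. by move=> f g h; apply/CspaceP => a; exact: addrA. Qed.
Fact Cspace_addC : commutative Cspace_add.
Proof. by move=> f g; apply/CspaceP => a; exact: addrC. Qed.
Fact Cspace_add0 : left_id Cspace0 Cspace_add.
Proof. by move=> f; apply/CspaceP => a; exact: add0r. Qed.
Fact Cspace_addN : left_inverse Cspace0 Cspace_opp Cspace_add.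
Proof. by move=> f; apply/CspaceP => a; exact: addNr. Qed.

HB.instance Definition _ := GRing.isZmodule.Build (Cspace A R)
  Cspace_addA Cspace_addC Cspace_add0 Cspace_addN.

Fact Cspace_scaleA (k l : R) f :
  Cspace_scale k (Cspace_scale l f) = Cspace_scale (k * l) f.
Proof. by apply/CspaceP => a; exact: mulrA. Qed.
Fact Cspace_scale1 : left_id 1 Cspace_scale.
Proof. by move=> f; apply/CspaceP => a; exact: mul1r. Qed.
Fact Cspace_scaleDr : right_distributive Cspace_scale +%R.
Proof. by move=> k f g; apply/CspaceP => a; exact: mulrDr. Qed.
Fact Cspace_scaleDl f :
  {morph Cspace_scale^~ f : k l / k + l >-> (k + l)%R}.
Proof. by move=> k l; apply/CspaceP => a; exact: mulrDl. Qed.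

HB.instance Definition _ := GRing.Zmodule_isLmodule.Build R (Cspace A R)
  Cspace_scaleA Cspace_scale1 Cspace_scaleDr Cspace_scaleDl.

Lemma Cspace_addE f g a : (f + g) a = f a + g a. Proof. by []. Qed.
Lemma Cspace_oppE f a : (- f) a = - f a. Proof. by []. Qed.
Lemma Cspace_scaleE (k : R) f a : (k *: f) a = k * f a. Proof. by []. Qed.
Lemma Cspace_0E a : (0 : Cspace A R) a = 0. Proof. by []. Qed.

(* sup set0 = 0, so this is also right on the empty space. *)
Definition sup_norm f : R := sup (range (fun a => `|f a|)).

Lemma Cspace_bounded f : has_ubound (range (fun a => `|f a|)).
Proof.
have cf : continuous (fun a => `|f a|).
  by move=> a; apply: cvg_norm; exact: Cspace_continuous.
have := continuous_compact (continuous_subspaceT cf) compact_setT.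
move=> /compact_bounded [M [Mreal MP]].
exists (M + 1) => _ [a _ <-].
apply: le_trans (ler_norm _) _.
by apply: (MP (M + 1)) => /=; [rewrite ltrDl ltr01|exists a].
Qed.

Lemma le_sup_norm f a : `|f a| <= sup_norm f.
Proof. by apply: ub_le_sup; [exact: Cspace_bounded|exists a]. Qed.

Lemma sup_norm_ge0 f : 0 <= sup_norm f.
Proof.
have [[_ [a _ _]]|/set0P/negP] := pselect (range (fun a => `|f a|) !=set0).
  exact: le_trans (le_sup_norm f a).
by rewrite negbK => /eqP; rewrite /sup_norm => ->; rewrite sup0.
Qed.

Lemma sup_norm_le f (r : R) : 0 <= r -> (forall a, `|f a| <= r) ->
  sup_norm f <= r.
Proof.
move=> r0 fr.
have [ne|/set0P/negP] := pselect (range (fun a => `|f a|) !=set0).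
  by apply: ge_sup => // _ [a _ <-].
by rewrite negbK => /eqP; rewrite /sup_norm => ->; rewrite sup0.
Qed.

Fact sup_normD f g : sup_norm (f + g) <= sup_norm f + sup_norm g.
Proof.
apply: sup_norm_le => [|a]; first by rewrite addr_ge0 ?sup_norm_ge0.
by rewrite (le_trans (ler_normD _ _))// lerD ?le_sup_norm.
Qed.

Fact sup_normZ (k : R) f : sup_norm (k *: f) = `|k| * sup_norm f.
Proof.
have le_scale (l : R) g : sup_norm (l *: g) <= `|l| * sup_norm g.
  apply: sup_norm_le => [|a]; first by rewrite mulr_ge0 ?sup_norm_ge0.
  by rewrite Cspace_scaleE normrM ler_wpM2l ?le_sup_norm.
apply/eqP; rewrite eq_le le_scale /=.
have [->|k0] := eqVneq k 0; first by rewrite normr0 mul0r sup_norm_ge0.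
rewrite -ler_pdivlMl ?normr_gt0// -normfV.
by rewrite (le_trans _ (le_scale _ _))// scalerA mulVf// scale1r.
Qed.

Fact sup_norm_eq0 f : sup_norm f = 0 -> f = 0.
Proof.
move=> f0; apply/CspaceP => a; apply/eqP.
by rewrite -normr_le0 -f0 le_sup_norm.
Qed.

HB.instance Definition _ := Lmodule_isNormed.Build R (Cspace A R)
  sup_normD sup_normZ sup_norm_eq0.

Lemma Cspace_normE f : `|f| = sup (range (fun a => `|f a|)).
Proof. by []. Qed.

Fact Cspace_complete (F : set_system (Cspace A R)) :
  ProperFilter F -> cauchy F -> cvg F.
Proof.
move=> FF /cauchy_ballP Fc.
pose G : set_system (arrow_uniform_type A R) := (fun f => f : A -> R) @ F.
have Gc : cauchy G.
  apply/cauchy_ballP => e e0.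
  have [[P Q] /= [FP FQ] PQ] := Fc e e0.
  exists ((fun f : Cspace A R => f : A -> R) @` P,
          (fun f : Cspace A R => f : A -> R) @` Q) => /=.
    by split; [apply: filterS FP|apply: filterS FQ] => f ?; exists f.
  move=> [_ _] /= [[f Pf <-] [g Qg <-]] a.
  have := PQ (f, g) (conj Pf Qg); rewrite -!ball_normE /=.
  by apply: le_lt_trans; exact: (le_sup_norm (f - g)).
have Gh : G --> lim G by exact: cauchy_cvg.
set h := lim G in Gh.
have ch : continuous (h : A -> R).
  apply: (@uniform_limit_continuous A R G).
  - rewrite near_map; apply: nearW => f; exact: Cspace_continuous.
  - by move=> B; rewrite uniform_nbhsT => /Gh.
apply/cvg_ex; exists (mkCspace ch).
apply/cvgrPdist_le => e e0.
have /Gh : nbhs (h : arrow_uniform_type A R) (ball (h : arrow_uniform_type A R) e).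
  exact: nbhsx_ballx.
rewrite /G /nbhs /=; apply: filterS => f hf.
apply: sup_norm_le => [|a]; first exact: ltW.
by have := hf a; rewrite -ball_normE /= => /ltW.
Qed.

HB.instance Definition _ :=
  Uniform_isComplete.Build (Cspace A R) Cspace_complete.

End Cspace_normed.

(* Words of length n.+1, with the product topology. *)
Definition nword (A : topologicalType) (n : nat) : topologicalType :=
  {ptws 'I_n.+1 -> A}.

(* Non-empty words, with the disjoint union topology; the first component of
   a word is its length minus one. *)
Definition words (A : topologicalType) : topologicalType :=
  {n : nat & nword A n}.

Definition wsize (A : topologicalType) (w : words A) : nat := (projT1 w).+1.

Definition letter (A : topologicalType) (w : words A) : 'I_(wsize w) -> A :=
  projT2 w.
Arguments letter {A} w i.

Definition substitution (A : topologicalType) : Type :=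
  continuousType A (words A).

Definition letter_surjective (A : topologicalType) (rho : substitution A) :=
  forall a : A, exists b : A, exists i : 'I_(wsize (rho b)), letter (rho b) i = a.

Section substitution_operator.
Context {A : compactHausdorffType} {R : realType}.
Variable rho : substitution A.

Lemma subst_op_subproof (f : Cspace A R) :
  continuous (fun a => \sum_(i < wsize (rho a)) f (letter (rho a) i)).
Proof.
pose S (n : nat) (u : nword A n) : R := \sum_(i < n.+1) f (u i).
have cS : continuous (unstable.sigT_fun S : words A -> R).
  apply: sigT_continuous => n; apply: continuous_big => [|i _ u].
    exact: add_continuous.
  apply: (@continuous_comp _ _ _ (fun v : nword A n => v i) f).
    exact: (@proj_continuous _ (fun=> A) i).
  exact: Cspace_continuous.
move=> a.
rewrite (_ : (fun a => _) = unstable.sigT_fun S \o rho); last first.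
  by apply/funext => b /=; rewrite /letter /wsize; case: (rho b).
by apply: continuous_comp; [exact: cts_fun|exact: cS].
Qed.

Definition subst_op (f : Cspace A R) : Cspace A R :=
  mkCspace (@subst_op_subproof f).

Lemma subst_opE f a : subst_op f a = \sum_(i < wsize (rho a)) f (letter (rho a) i).
Proof. by []. Qed.

Fact subst_op_linear : linear subst_op.
Proof.
move=> k f g; apply/CspaceP => a.
rewrite Cspace_addE Cspace_scaleE !subst_opE mulr_sumr -big_split /=.
by apply: eq_bigr.
Qed.

HB.instance Definition _ :=
  GRing.isLinear.Build R (Cspace A R) (Cspace A R) _ subst_op subst_op_linear.

End substitution_operator.

Definition compact_operator (R : realType) (V W : normedModType R)
    (T : {linear V -> W}) : Prop :=
  forall B : set V, bounded_set B -> precompact (T @` B).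

(* Main.v *)
Require Import Defs.
From mathcomp Require Import all_boot all_order all_algebra.
From mathcomp Require Import all_classical all_reals all_analysis.
From mathcomp Require Import lra.

Import Order.TTheory GRing.Theory Num.Theory.

Local Open Scope classical_set_scope.

(** A compact [M] maps the unit ball of [C(A)] to an equicontinuous family.
If, for [b'] close to [b], some letter [c] of [rho b'] did not occur in
[rho b], a Urysohn function [f] vanishing on the letters of [rho b] with
[f c = 1] would give [M f b = 0] and [M f b' >= 1]. So the letters of
[rho b'] are among those of [rho b] for all [b'] near [b]; by compactness
only finitely many letters occur at all, and letter surjectivity makes [A]
finite. *)

Section equicontinuity.
Local Open Scope ring_scope.

(** A neighbourhood of [b] that suits one [g] in [K] up to [e / 3] suits every [h] within [e / 3] of
    [g] up to [e], by the triangle inequality; compactness of [K] makes the choice uniform. *)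
Lemma compact_equicontinuous (A : compactHausdorffType) (R : realType)
    (K : set (Cspace A R)) (b : A) (e : R) :
  compact K -> 0 < e ->
  \forall b' \near b, K `<=` [set g | `|g b' - g b| < e].
Proof.
move=> /compact_near_coveringP cK e0; apply: cK => g _.
have e3 : 0 < e / 3 by rewrite divr_gt0.
have gb : \forall b' \near b, `|g b' - g b| < e / 3.
  have /cvgrPdist_lt /(_ _ e3)  := @Cspace_continuous A R g b.
  by apply: filterS => b'; rewrite distrC.
exists (ball g (e / 3), [set b' | `|g b' - g b| < e / 3]) => /=.
  by split=> //; exact: nbhsx_ballx.
move=> [h b'] /=; rewrite -ball_normE /= => -[gh gb'].
have ghx x : `|g x - h x| < e / 3 := le_lt_trans (le_sup_norm (g - h) x) gh.
have := ghx b; have := ghx b'; move: gb'; rewrite !ltr_norml.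
by move=> /andP[? ?] /andP[? ?] /andP[? ?]; apply/andP; split; lra.
Qed.

(** Urysohn's lemma, as compact Hausdorff spaces are normal. The bounds put [f] in the unit ball and
    keep all summands of [subst_op rho f] nonnegative. *)
Lemma Cspace_separate_finite (A : compactHausdorffType) (R : realType)
    (F : set A) (c : A) :
  finite_set F -> ~ F c ->
  exists f : Cspace A R,
    [/\ forall a, 0 <= f a <= 1, forall a, F a -> f a = 0 & f c = 1].
Proof.
move=> finF Fc.
have acc : accessible_space A by apply: hausdorff_accessible hausdorff_setT.
have cloF : closed F by move/accessible_finite_set_closed: acc; exact.
have : uniform_separator F [set c].
  apply: (normal_uniform_separator
    (compact_normal hausdorff_setT compact_setT)) => //.
    exact: accessible_closed_set1.
  by rewrite -subset0 => x [Fx xc]; apply: Fc; rewrite -xc.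
move=> /(@uniform_separatorP _ R)[f [cf f01 f0 f1]].
exists (mkCspace cf); split=> [a|a Fa|].
- by have /= := f01 (f a) (imageT f a); rewrite in_itv.
- by apply: f0; exists a.
- by apply: f1; exists c.
Qed.

Lemma compact_subst_op_letters (R : realType) (A : compactHausdorffType)
    (rho : substitution A) (b : A) :
  compact_operator (subst_op rho : {linear Cspace A R -> Cspace A R}) ->
  \forall b' \near b,
    range (letter (rho b')) `<=` range (letter (rho b)).
Proof.
move=> /(_ [set f | `|f| <= 1]) [].
  by exists 1; split=> [|M M1 f /= f1]; rewrite ?real1// (le_trans f1)// ltW.
move=> K TK [cK _].
(* The tolerance is 1 because a new letter at [b'] would force a jump of at least 1. *)
have := compact_equicontinuous _ _ _ b _ cK ltr01; apply: filterS => b' Kb' _ [i _ <-].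
apply: contrapT => nb.
have finb : finite_set (range (letter (rho b))).
  exact/finite_image/finite_finset.
have [f [f01 f0 f1]] := Cspace_separate_finite _ R _ _ finb nb.
have /Kb' /= : K (subst_op rho f).
  apply: TK; exists f => //=; apply: sup_norm_le => // a.
  by have /andP[? ?] := f01 a; rewrite ger0_norm.
rewrite !subst_opE [X in _ - X]big1 ?subr0 => [|j _]; last first.
  by apply: f0; exists j.
(* The letter at [i] alone contributes 1 to the value at [b']. *)
apply/negP; rewrite -leNgt (bigD1 i)//= f1.
have s0 : 0 <= \sum_(j < wsize (rho b') | j != i) f (letter (rho b') j).
  by apply: sumr_ge0 => j _; have /andP[] := f01 (letter (rho b') j).
by rewrite ger0_norm ?addr_ge0// lerDl.
Qed.

End equicontinuity.

Theorem proposition6p2 (R : realType) (A : compactHausdorffType)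
    (rho : substitution A) :
  infinite_set [set: A] -> letter_surjective rho ->
  ~ compact_operator (subst_op rho : {linear Cspace A R -> Cspace A R}).
Proof.
move=> infA surj cptM; apply: infA.
pose L b := range (letter (rho b)).
have finL b : finite_set (L b) by exact/finite_image/finite_finset.
(* [compact_cover] requires a pointed type; the upward filter on finite sets
   of letters plays the role of the finite subcover. *)
pose up := filter_from (@finite_set A) (fun S => [set S' | S `<=` S']).
have upF : Filter up.
  apply: filter_from_filter; first by exists set0; exact: finite_set0.
  move=> S S' fS fS'; exists (S `|` S'); first by rewrite finite_setU.
  by move=> B /=; rewrite subUset.
have [S finS LS] : \forall S \near up, [set: A] `<=` [set b | L b `<=` S].
  apply: (compact_near_coveringP _).1 compact_setT _ _ _ _ _ => b _.
  exists ([set b' | L b' `<=` L b], [set S | L b `<=` S]) => /=.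
    by split; [exact: compact_subst_op_letters cptM|exists (L b)].
  by move=> [b' S] /= [bb' bS]; exact: subset_trans bb' bS.
(* [S] contains the letters of every [rho b], hence all of [A]. *)
apply: (sub_finite_set _ finS) => a _; have [b [i ai]] := surj a.
by apply: (LS S _ b) => //; exists i.
Qed.
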